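(* Let $V$ be an $\ell$-Volterra quadratic stochastic operator on $S^{m-1}$ with associated coefficients $a_{ki}$. Let $1\le r\le \ell$, $r<m$, and suppose $a_{ki}<0$ for all $k=1,\dots,r$ and $i=r+1,\dots,m$. Then for any $p=(p_1,\dots,p_r)\in S^{r-1}$ the function $$\psi_p(x)=x_1^{p_1}\cdots x_r^{p_r}$$ is a Lyapunov function for $V$.
   Context: Let $E=\{1,\dots,m\}$, $S^{n-1}=\{x\in\mathbb{R}^n: x_i\ge 0,\ \sum_{i=1}^n x_i=1\}$, $\mathrm{int}\,S^{m-1}=\{x\in S^{m-1}:\prod_{i=1}^m x_i>0\}$. A quadratic stochastic operator is a map $V:S^{m-1}\to S^{m-1}$, $V(x)_k=\sum_{i,j=1}^m P_{ij,k}x_ix_j$, where $P_{ij,k}\ge 0$, $P_{ij,k}=P_{ji,k}$, $\sum_{k=1}^m P_{ij,k}=1$ for all $i,j,k\in E$. For a fixed $\ell\in E$, $V$ is called $\ell$-Volterra if (i) $P_{ij,k}=0$ whenever $k\in\{1,\dots,\ell\}$, $i,j\in E$ and $k\notin\{i,j\}$; and (ii) for every $k\in\{\ell+1,\dots,m\}$ there is at least one pair $(i,j)$ with $i\ne k$, $j\ne k$ and $P_{ij,k}>0$. Its associated coefficients are $a_{ki}=2P_{ik,k}-1$ for $k\ne i$ and $a_{kk}=P_{kk,k}-1$ ($k,i\in E$). For $k\le\ell$ one then has $V(x)_k=x_k(1+\sum_{i=1}^m a_{ki}x_i)$. The trajectory of $x^0$ is $x^{(0)}=x^0$, $x^{(n+1)}=V(x^{(n)})$.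 A continuous function $\varphi:\mathrm{int}\,S^{m-1}\to\mathbb{R}$ is called a Lyapunov function for $V$ if $\lim_{n\to\infty}\varphi(x^{(n)})$ exists (as a real number) for any initial point $x^0\in\mathrm{int}\,S^{m-1}$. Here $\psi_p$ is extended from $\mathrm{int}\,S^{m-1}$ to $S^{m-1}$ by the same formula with the convention $0^0=1$. *)

(* Defs.v *)
From HB Require Import structures.
From mathcomp Require Import all_boot all_order all_algebra.
From mathcomp Require Import all_classical all_reals all_analysis.
Set Implicit Arguments.
Unset Strict Implicit.
Unset Printing Implicit Defensive.
Import Order.TTheory GRing.Theory Num.Theory.
Import numFieldNormedType.Exports.
Local Open Scope classical_set_scope.
Local Open Scope ring_scope.

Section QuadraticStochasticOperators.
Context {R : realType}.

(* S^(n-1) and its relative interior, in R^n. Indices are shifted by one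
   throughout: the element k of {1, ..., n} is the ordinal k - 1 of 'I_n. *)
Definition simplex (n : nat) : set 'rV[R]_n :=
  [set x | (forall i, 0 <= x 0 i) /\ \sum_(i < n) x 0 i = 1].

Definition int_simplex (n : nat) : set 'rV[R]_n :=
  [set x | simplex x /\ 0 < \prod_(i < n) x 0 i].

(* [P i j k] is P_{ij,k}. *)
Definition is_qso_coef (m : nat) (P : 'I_m -> 'I_m -> 'I_m -> R) : Prop :=
  [/\ forall i j k, 0 <= P i j k,
      forall i j k, P i j k = P j i k
    & forall i j, \sum_(k < m) P i j k = 1].

(* The quadratic map is defined on all of R^m; [qso_simplex] shows that it
   restricts to a self-map of the simplex. *)
Definition qso (m : nat) (P : 'I_m -> 'I_m -> 'I_m -> R) (x : 'rV[R]_m) :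
    'rV[R]_m :=
  \row_(k < m) \sum_(i < m) \sum_(j < m) P i j k * x 0 i * x 0 j.

Lemma qso_simplex (m : nat) (P : 'I_m -> 'I_m -> 'I_m -> R) (x : 'rV[R]_m) :
  is_qso_coef P -> simplex x -> simplex (qso P x).
Proof.
move=> [P0 _ P1] [x0 x1]; split=> [k|].
  by rewrite mxE; do 2!apply: sumr_ge0 => ? _; rewrite !mulr_ge0.
under eq_bigr do rewrite mxE.
rewrite exchange_big /=; under eq_bigr => i _.
  rewrite exchange_big /=; under eq_bigr => j _.
    by under eq_bigr do rewrite -mulrA; rewrite -mulr_suml P1 mul1r; over.
  by rewrite -mulr_sumr x1 mulr1; over.
by [].
Qed.

(* With ordinals, [(k < l)%N] means k \in {1, ..., l} and [(l <= k)%N] means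
   k \in {l+1, ..., m}. *)
Definition is_volterra (m l : nat) (P : 'I_m -> 'I_m -> 'I_m -> R) : Prop :=
  (forall i j k : 'I_m, (k < l)%N -> k != i -> k != j -> P i j k = 0) /\
  (forall k : 'I_m, (l <= k)%N ->
     exists i j : 'I_m, [/\ i != k, j != k & 0 < P i j k]).

Definition volterra_coef (m : nat) (P : 'I_m -> 'I_m -> 'I_m -> R)
    (k i : 'I_m) : R :=
  if k == i then P k k k - 1 else 2 * P i k k - 1.

(* Trajectories starting in the interior may reach the boundary, so [phi] is
   given on the ambient space and its values on the whole simplex matter for
   the limit; continuity is only required on the interior. *)
Definition is_lyapunov (m : nat) (V : 'rV[R]_m -> 'rV[R]_m)
    (phi : 'rV[R]_m -> R) : Prop :=
  {within @int_simplex m, continuous phi} /\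
  (forall x0, int_simplex x0 ->
     exists c : R, phi (iter n V x0) @[n --> \oo] --> c).

(* [powR] satisfies 0 `^ 0 = 1 and 0 `^ a = 0 for a <> 0. *)
Definition psi (m r : nat) (le_rm : (r <= m)%N) (p : 'rV[R]_r)
    (x : 'rV[R]_m) : R :=
  \prod_(k < r) x 0 (widen_ord le_rm k) `^ p 0 k.

End QuadraticStochasticOperators.

(* Main.v *)
Require Import Defs.
From HB Require Import structures.
From mathcomp Require Import all_boot all_order all_algebra.
From mathcomp Require Import all_classical all_reals all_analysis.
From mathcomp Require Import lra ring.
Set Implicit Arguments.
Unset Strict Implicit.
Unset Printing Implicit Defensive.
Import Order.TTheory GRing.Theory Num.Theory.
Import numFieldNormedType.Exports.
Local Open Scope classical_set_scope.
Local Open Scope ring_scope.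

(** The limit of psi_p along every trajectory that starts in the interior
    is 0.  Write s(x) for the total mass x_1 + ... + x_r.  Since p is a
    probability vector, psi_p(x) is a weighted geometric mean of x_1, ..., x_r,
    hence at most s(x) ([psi_le]), and it suffices that s tends to 0.

    Expand s(V(x)) as a quadratic form in x.  A product x_i x_j keeps in
    {1, ..., r} at most its whole weight if i, j <= r, nothing if i, j > r (a type
    k <= r is never created by a pair from which it is absent), and the weight
    P_{ij,i} = (1 + a_{ij}) / 2 if i <= r < j.  If a_{ij} were 0, mixed pairs
    would give half of their weight to the first r types, which is what s(x)
    requires to stay constant; with a_{ij} <= -d < 0 there is a net loss, and
    summing gives
      s(V(x)) <= s(x) (1 - d (1 - s(x)))
    ([head_mass_contract]).  An interior starting point has s < 1 because
    r < m, and s can only decrease, so 1 - s stays bounded below by its initial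
    value and s decays geometrically. *)

Lemma continuous_powR_pos (R : realType) (p a : R) :
  0 < a -> {for a, continuous (fun b : R => b `^ p)}.
Proof.
move=> a0; apply/differentiable_continuous/derivable1_diffP.
by apply: derivable_powR; rewrite in_itv /= andbT.
Qed.

Lemma int_simplex_gt0 (R : realType) (m : nat) (x : 'rV[R]_m) (i : 'I_m) :
  int_simplex x -> 0 < x 0 i.
Proof.
move=> [[x0 _] /lt0r_neq0 /prodf_neq0 xN0].
by rewrite lt0r x0 andbT xN0.
Qed.

Lemma continuous_psi_int_simplex (R : realType) (m r : nat) (le_rm : (r <= m)%N)
    (p : 'rV[R]_r) :
  {within @int_simplex R m, continuous (psi le_rm p)}.
Proof.
apply: continuous_in_subspaceT => x; rewrite inE => x_int.
rewrite /psi; apply: (cvg_big _ (nbhs_filter x)) => [|k _]; first exact: mul_continuous.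
apply: (@continuous_comp _ _ _ (fun y : 'rV[R]_m => y 0 (widen_ord le_rm k))
  (fun b : R => b `^ p 0 k)); first exact: coord_continuous.
by apply: continuous_powR_pos; apply: int_simplex_gt0.
Qed.

(** A weighted geometric mean is at most any upper bound t of its terms, since
    the weighted powers of t multiply up to t `^ 1.  This additivity of
    exponents is delicate at 0, whence a positive t: the largest coordinate
    itself may vanish on the boundary. *)
Lemma psi_le (R : realType) (m r : nat) (le_rm : (r <= m)%N) (p : 'rV[R]_r)
    (x : 'rV[R]_m) (t : R) :
  simplex p -> 0 < t ->
  (forall k : 'I_m, (k < r)%N -> 0 <= x 0 k <= t) -> psi le_rm p x <= t.
Proof.
move=> [p0 p1] t0 xt.
have -> : t = \prod_(k < r) t `^ p 0 k.
  rewrite -[LHS](powRr1 (ltW t0)) -[X in t `^ X]p1.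
  apply: (big_morph (powR t)) => [a b|]; last exact: powRr0.
  by rewrite powRD // lt0r_neq0 ?implybT.
apply: ler_prod => k _; rewrite powR_ge0 /=.
have /andP[x0 xk_le] := xt (widen_ord le_rm k) (ltn_ord k).
by apply: ge0_ler_powR; rewrite ?nnegrE // ltW.
Qed.

Definition head_mass (R : realType) (m r : nat) (x : 'rV[R]_m) : R :=
  \sum_(k < m | (k < r)%N) x 0 k.

(** Finitely many negative numbers are uniformly negative.  The bound d <= 1
    keeps the contraction factor 1 - d (1 - s) positive for 0 < s < 1. *)
Lemma volterra_coef_gap (R : realType) (m r : nat)
    (P : 'I_m -> 'I_m -> 'I_m -> R) :
  (forall k i : 'I_m, (k < r)%N -> (r <= i)%N -> volterra_coef P k i < 0) ->
  exists d : R, 0 < d <= 1 /\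
    forall k i : 'I_m, (k < r)%N -> (r <= i)%N -> volterra_coef P k i <= - d.
Proof.
move=> ha.
(* The default -1 makes d = - M at most 1, even when the range is empty. *)
pose M : R := \big[Num.max/-1]_(ki : 'I_m * 'I_m | (ki.1 < r)%N && (r <= ki.2)%N)
  volterra_coef P ki.1 ki.2.
exists (- M); split.
  rewrite oppr_gt0 lerNl; apply/andP; split; last exact: bigmax_ge_id.
  by apply: bigmax_lt => [|ki /andP[? ?]]; [lra | exact: ha].
move=> k i kr ri; rewrite opprK.
by apply: (bigmax_sup (k, i)) => //=; rewrite kr ri.
Qed.

(** Logistic-type decay of the mass s of the first r types: pairs inside one
    group never increase it, and the loss comes from the mixed pairs, whose
    total weight is 2 s (1 - s), at a rate of at least d / 2. *)
Lemma head_mass_contract (R : realType) (m l r : nat)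
    (P : 'I_m -> 'I_m -> 'I_m -> R) (d : R) (x : 'rV[R]_m) :
  is_qso_coef P -> is_volterra l P -> (r <= l)%N ->
  (forall k i : 'I_m, (k < r)%N -> (r <= i)%N -> volterra_coef P k i <= - d) ->
  simplex x ->
  head_mass r (qso P x) <= head_mass r x * (1 - d * (1 - head_mass r x)).
Proof.
move=> [P0 Psym P1] [volt _] rl ad [x0 x1].
(* Q i j is the share of the offspring of the pair (i, j) among the first r
   types. *)
pose Q i j := \sum_(k < m | (k < r)%N) P i j k.
have Psupp (i j k : 'I_m) : (k < r)%N -> k != i -> k != j -> P i j k = 0.
  by move=> kr; apply: volt; exact: leq_trans rl.
have Qmixed (i j : 'I_m) : (i < r)%N -> (r <= j)%N -> Q i j <= (1 - d) / 2.
  move=> ir rj; have ij : i != j by apply: contraTneq ir => ->; rewrite -leqNgt.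
  rewrite /Q (bigD1 i) //= big1 ?addr0 => [|k /andP[kr ki]].
    have := ad i j ir rj; rewrite /volterra_coef (negPf ij) Psym; lra.
  by apply: Psupp => //; apply: contraTneq kr => ->; rewrite -leqNgt.
have Qsym i j : Q i j = Q j i by apply: eq_bigr => k _.
(* With u the indicator of the first r types, the three cases of the bound on
   Q merge into one expression that is bilinear in u and 1 - u, so that the
   double sum below factors into products of single sums. *)
pose u (i : 'I_m) : R := (i < r)%N%:R.
have Qle i j : Q i j <=
    (u i + u j - d * (u i * (1 - u j) + (1 - u i) * u j)) / 2.
  rewrite /u; case: ltnP => ir; case: ltnP => jr /=.
  - apply: (@le_trans _ _ 1); last lra.
    by rewrite -(P1 i j) [leRHS](bigID (fun k : 'I_m => (k < r)%N)) /= lerDl sumr_ge0.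
  - have := Qmixed _ _ ir jr; lra.
  - have := Qmixed _ _ jr ir; rewrite Qsym; lra.
  - rewrite /Q big1; first lra.
    by move=> k kr; apply: Psupp => //; apply: contraTneq kr => ->; rewrite -leqNgt.
pose y i := u i * x 0 i; pose z i := (1 - u i) * x 0 i.
have sum_y : \sum_i y i = head_mass r x.
  rewrite /head_mass [RHS]big_mkcond; apply: eq_bigr => i _.
  by rewrite /y /u; case: ifP; rewrite ?mul1r ?mul0r.
have sum_z : \sum_i z i = 1 - head_mass r x.
  rewrite -x1 -sum_y -sumrB; apply: eq_bigr => i _; rewrite /z /y; ring.
have -> : head_mass r (qso P x) = \sum_i \sum_j Q i j * (x 0 i * x 0 j).
  rewrite /head_mass; under eq_bigr do rewrite mxE.
  rewrite exchange_big; apply: eq_bigr => i _ /=.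
  rewrite exchange_big; apply: eq_bigr => j _ /=.
  by rewrite mulr_suml; apply: eq_bigr => k _; rewrite mulrA.
have -> : head_mass r x * (1 - d * (1 - head_mass r x)) =
    \sum_i \sum_j ((y i * x 0 j + x 0 i * y j) -
                   d * (y i * z j + z i * y j)) / 2.
  under eq_bigr do rewrite -mulr_suml sumrB -mulr_sumr !big_split /=.
  rewrite -mulr_suml sumrB -mulr_sumr !big_split /= -!big_distrlr /=.
  by rewrite x1 sum_y sum_z; field.
apply: ler_sum => i _; apply: ler_sum => j _.
have := ler_wpM2r (mulr_ge0 (x0 i) (x0 j)) (Qle i j).
by move=> /le_trans; apply; rewrite /y /z le_eqVlt; apply/orP; left; apply/eqP; field.
Qed.

Theorem theorem3 (R : realType) (m l r : nat)
    (P : 'I_m -> 'I_m -> 'I_m -> R)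
    (hl : (1 <= l <= m)%N)
    (hP : is_qso_coef P) (hV : is_volterra l P)
    (hr1 : (1 <= r)%N) (hrl : (r <= l)%N) (hrm : (r < m)%N)
    (ha : forall k i : 'I_m, (k < r)%N -> (r <= i)%N -> volterra_coef P k i < 0)
    (p : 'rV[R]_r) (hp : simplex p) :
  is_lyapunov (qso P) (psi (ltnW hrm) p).
Proof.
split; first exact: continuous_psi_int_simplex.
move=> x0 x0_int; exists 0.
have [d [/andP[d0 d1] ad]] := volterra_coef_gap ha.
have x_simplex n : simplex (iter n (qso P) x0).
  by elim: n => [|n IHn] /=; [case: x0_int | exact: qso_simplex].
pose s := head_mass r x0; pose q := 1 - d * (1 - s).
have s_gt0 : 0 < s.
  pose i0 : 'I_m := Ordinal (ltn_trans hr1 hrm).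
  rewrite /s /head_mass (bigD1 i0) //= ltr_pwDl ?int_simplex_gt0 //.
  by apply: sumr_ge0 => k _; rewrite ltW // int_simplex_gt0.
have s_lt1 : s < 1.
  have [_ <-] := x_simplex 0; pose i1 : 'I_m := Ordinal hrm.
  rewrite [ltRHS](bigID (fun k : 'I_m => (k < r)%N)) /= ltrDl.
  rewrite (bigD1 i1) /= ?ltnn // ltr_pwDl ?int_simplex_gt0 //.
  by apply: sumr_ge0 => k _; rewrite ltW // int_simplex_gt0.
have q_gt0 : 0 < q by rewrite /q; nra.
have q_lt1 : q < 1 by rewrite /q; nra.
have mass_ge0 n : 0 <= head_mass r (iter n (qso P) x0).
  by apply: sumr_ge0 => k _; have [+ _] := x_simplex n; apply.
have mass_le n : head_mass r (iter n (qso P) x0) <= s * q ^+ n.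
  elim: n => [|n IHn]; first by rewrite expr0 mulr1.
  apply: le_trans (head_mass_contract hP hV hrl ad (x_simplex n)) _.
  rewrite exprSr mulrA; set sn := head_mass _ _ in IHn *.
  have sn_le : sn <= s.
    by apply: le_trans IHn _; rewrite ler_piMr ?(ltW s_gt0) // exprn_ile1 ?ltW.
  have := mass_ge0 n; rewrite -/sn => sn_ge0.
  apply: (@le_trans _ _ (sn * q)); last by rewrite ler_wpM2r // ltW.
  by rewrite ler_wpM2l // /q; nra.
apply: (@squeeze_cvgr _ _ _ _ (fun=> 0) (geometric s q)).
- near=> n; apply/andP; split; first by apply: prodr_ge0 => k _; exact: powR_ge0.
  apply: psi_le => // [|k kr]; first by rewrite /= mulr_gt0 // exprn_gt0.
  have [xn0 _] := x_simplex n; rewrite xn0 /=.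
  apply: le_trans (mass_le n); rewrite /head_mass (bigD1 k) //= lerDl.
  by apply: sumr_ge0 => j _.
- exact: cvg_cst.
- by apply: cvg_geometric; rewrite ger0_norm // ltW.
Unshelve. all: by end_near. Qed.
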